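(* Let $\mathbb{K}$ be a field and $R=\mathbb{K}[x_1,\dots,x_n]$. If $I\subset R$ is an ass-decomposable monomial ideal, then $$\mathrm{depth}(R/I)=\min\{\mathrm{depth}(R/\mathfrak{p}) : \mathfrak{p}\in\mathrm{ass}(I)\}=n-\mathrm{bigh}(I).$$
   Context: Depth is taken with respect to the graded maximal ideal $\mathfrak{m}=(x_1,\dots,x_n)$. For an ideal $I\subseteq R$, $\mathrm{ass}(I)$ is the set of associated primes of $R/I$, and $\mathrm{bigh}(I)=\max\{\mathrm{ht}(\mathfrak{p}) : \mathfrak{p}\in\mathrm{ass}(I)\}$ is the big height of $I$. Recursively, a (proper) monomial ideal $I\subset R$ is called ass-decomposable if either it is a primary ideal, or else there exist a variable $x_i\notin\sqrt{I}$ and a positive integer $k$ such that (i) $\mathrm{ass}(I+(x_i^k))=\{\mathfrak{p}\in\mathrm{ass}(I) : x_i\in\mathfrak{p}\}$, and (ii) both $I+(x_i^k)$ and $I:x_i^k$ are ass-decomposable. *)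

(* Defs.v *)
From mathcomp Require Import all_boot all_order all_algebra.
From mathcomp Require Import boolp classical_sets.
From mathcomp Require Import mpoly.

Set Implicit Arguments.
Unset Strict Implicit.
Unset Printing Implicit Defensive.

Import GRing.Theory.
Local Open Scope ring_scope.
Local Open Scope classical_set_scope.

(* Ideals are Prop-valued sets, as colon ideals and associated primes have no
   decidable membership in general.  The extrema below are relations, so that
   [is_maximum S d] also asserts that the maximum exists. *)

Definition is_maximum (S : set nat) (d : nat) : Prop :=
  S d /\ forall e, S e -> (e <= d)%N.

(* [v a e] reads "the value attached to [a] is [e]" (a functional relation);
   every element of [A] is required to have a value. *)
Definition is_max_over (T : Type) (A : set T) (v : T -> nat -> Prop) (d : nat)
    : Prop :=
  (exists2 a, A a & v a d) /\
  (forall a, A a -> exists2 e, v a e & (e <= d)%N).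

Definition is_min_over (T : Type) (A : set T) (v : T -> nat -> Prop) (d : nat)
    : Prop :=
  (exists2 a, A a & v a d) /\
  (forall a, A a -> exists2 e, v a e & (d <= e)%N).

Section Ideals.
Variable R : comNzRingType.
Implicit Types (I J p m : set R) (s : seq R).

(* Unlike [idealr_closed], this allows the unit ideal. *)
Definition is_ideal I : Prop :=
  [/\ I 0, (forall f g, I f -> I g -> I (f + g))
    & forall f g, I g -> I (f * g)].

Definition is_proper_ideal I : Prop := is_ideal I /\ ~ I 1.

Definition is_prime_ideal p : Prop :=
  is_proper_ideal p /\ forall f g, p (f * g) -> p f \/ p g.

Definition is_primary_ideal I : Prop :=
  is_proper_ideal I /\ forall f g, I (f * g) -> I f \/ exists k, I (g ^+ k).

Definition ideal_gen (A : set R) : set R := smallest is_ideal A.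

(* I + (s_0, ..., s_(r-1)) *)
Definition ideal_add I s : set R := ideal_gen (I `|` [set f | f \in s]).

Definition colon I (f : R) : set R := [set g | I (g * f)].

Definition radical I : set R := [set f | exists k, I (f ^+ k)].

(* Associated primes of R/I: prime annihilators of elements of R/I. *)
Definition ass I : set (set R) :=
  [set p | is_prime_ideal p /\ exists f, p = colon I f].

(* p_0 < p_1 < ... < p_h = p *)
Definition prime_chain p (h : nat) (c : nat -> set R) : Prop :=
  [/\ (forall i, (i <= h)%N -> is_prime_ideal (c i)),
      (forall i, (i < h)%N -> c i `<` c i.+1) & c h = p].

Definition is_height p : nat -> Prop :=
  is_maximum [set h | exists c, prime_chain p h c].

Definition is_bigheight I : nat -> Prop := is_max_over (ass I) is_height.

(* s is a regular sequence on the module R/I: s_j is a nonzerodivisor on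
   R/(I + (s_0, ..., s_(j-1))) for each j, and R/(I + (s)) is nonzero. *)
Definition regular_on_quotient I s : Prop :=
  (forall j, (j < size s)%N -> forall g,
     ideal_add I (take j s) (s`_j * g) -> ideal_add I (take j s) g) /\
  ~ ideal_add I s 1.

(* depth of R/I with respect to m *)
Definition is_depth m I : nat -> Prop :=
  is_maximum [set d | exists s, [/\ size s = d, {in s, forall f, m f}
                                  & regular_on_quotient I s]].

End Ideals.

Section Monomial.
Variables (K : fieldType) (n : nat).
Implicit Type I : set {mpoly K[n]}.

Definition graded_max_ideal : set {mpoly K[n]} :=
  ideal_gen (range (fun i : 'I_n => 'X_i)).

Definition is_monomial_ideal I : Prop :=
  exists M : set 'X_{1..n}, I = ideal_gen [set 'X_[u] | u in M].

Inductive ass_decomposable : set {mpoly K[n]} -> Prop :=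
| AssDecPrimary I of is_monomial_ideal I & is_proper_ideal I
    & is_primary_ideal I : ass_decomposable I
| AssDecSplit I (i : 'I_n) (k : nat)
    of is_monomial_ideal I & is_proper_ideal I
    & ~ radical I 'X_i & (0 < k)%N
    & ass (ideal_add I [:: 'X_i ^+ k]) = [set p | ass I p /\ p 'X_i]
    & ass_decomposable (ideal_add I [:: 'X_i ^+ k])
    & ass_decomposable (colon I ('X_i ^+ k)) : ass_decomposable I.

End Monomial.

Arguments graded_max_ideal : clear implicits.

(* Main.v *)
Require Import Defs.
From mathcomp Require Import all_boot all_order all_algebra.
From mathcomp Require Import boolp classical_sets.
From mathcomp Require Import mpoly.
From mathcomp Require Import ring zify.

Set Implicit Arguments.
Unset Strict Implicit.
Unset Printing Implicit Defensive.

Import GRing.Theory.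
Local Open Scope ring_scope.
Local Open Scope classical_set_scope.

(** The upper bounds come from algebraic dependence and the lower bounds from
    one sequence that works for all the ideals involved.

    Associated primes of a monomial ideal are the ideals p_A generated by the
    variables in a set A ([ass_multigraded], by a leading monomial argument), so
    everything reduces to p_A having height |A| and to comparing the depth of
    R/I with the numbers n - |A|.

    Upper bounds.  More than n - |A| polynomials satisfy a relation modulo p_A
    ([algebraic_dependence], by counting monomials), which can be normalised so
    that its lexicographically lowest monomial has coefficient 1.  Along a
    regular sequence, or along elements separating the members of a chain of
    primes, the lowest monomial can be cancelled factor by factor, and this
    coefficient 1 survives ([lex_relation_regular], [lex_relation_chain]).  For
    a chain of primes ending in p_A this bounds the height of p_A by |A|.  For a
    sequence s of more than n - |A| elements of the maximal ideal, regular on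
    R/I, and p_A = I : f, it puts f into I + (s); since the powers of the
    elements of s again form a regular sequence, f would lie in I + m^N for all
    N, hence in I ([regular_length_le]).  Thus depth(R/I) <= n - |A| for every
    p_A in ass(I).

    Lower bounds.  By [weakly_regular_ext], a sequence regular on R/(J:y) and on
    R/(J+(y)) is regular on R/J.  The two pieces of an ass-decomposition have
    their associated primes among those of I, and a primary monomial ideal with
    radical p_A is filtered with factors R/p_A ([primary_filtration]).  Hence a
    sequence that is regular on R/p_A for all p_A in ass(I) is regular on R/I.
    The elementary symmetric polynomials of degrees r, ..., 1 form such a
    sequence as soon as |A| <= n - r for all these A
    ([weakly_regular_sym_seq]); taking r = n - bigh(I) gives the missing
    inequality.  Explicit polynomials replace the generic linear forms that
    would require an infinite field. *)

(** * Ideals as sets *)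

Section IdealTheory.
Variable R : comNzRingType.
Implicit Types (I J L p : set R) (f g x y : R) (s t : seq R).

Lemma ideal0 J : is_ideal J -> J 0. Proof. by case. Qed.
Lemma idealD J f g : is_ideal J -> J f -> J g -> J (f + g).
Proof. by case=> _ + _; apply. Qed.
Lemma idealMl J f g : is_ideal J -> J g -> J (f * g).
Proof. by case=> _ _; apply. Qed.
Lemma idealMr J f g : is_ideal J -> J g -> J (g * f).
Proof. by rewrite mulrC; apply: idealMl. Qed.
Lemma idealN J f : is_ideal J -> J f -> J (- f).
Proof. by move=> hJ; rewrite -mulN1r; apply: idealMl. Qed.
Lemma idealB J f g : is_ideal J -> J f -> J g -> J (f - g).
Proof. by move=> hJ Jf Jg; apply: idealD => //; apply: idealN. Qed.
Lemma idealDr J f g : is_ideal J -> J f -> J (f + g) -> J g.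
Proof.
by move=> hJ Jf Jfg; rewrite -(addrK f g) [g + f]addrC; apply: idealB.
Qed.

Lemma ideal_sum J (T : eqType) (r : seq T) (F : T -> R) :
  is_ideal J -> {in r, forall i, J (F i)} -> J (\sum_(i <- r) F i).
Proof.
move=> hJ JF; rewrite big_seq; apply: (big_ind J) => //; first exact: ideal0.
by move=> f g; apply: idealD.
Qed.

Lemma ideal_full J f : is_ideal J -> J 1 -> J f.
Proof. by move=> hJ J1; rewrite -(mulr1 f); apply: idealMl. Qed.

Lemma ideal_gen_is_ideal (A : set R) : is_ideal (ideal_gen A).
Proof.
split=> [L [[]]//|f g hf hg L hL|f g hg L hL].
  by apply: idealD; [case: hL|exact: hf|exact: hg].
by apply: idealMl; [case: hL|exact: hg].
Qed.

Lemma ideal_gen_sub (A : set R) L :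
  is_ideal L -> A `<=` L -> ideal_gen A `<=` L.
Proof. exact: smallest_sub. Qed.

(* The conclusion unfolds to a product, whose binders would otherwise be counted
   among the implicit arguments here and below. *)
Lemma ideal_gen_incl (A : set R) : A `<=` ideal_gen A.
Proof. exact: sub_gen_smallest. Qed.
Arguments ideal_gen_incl : clear implicits.


Lemma ideal_add_is_ideal J s : is_ideal (ideal_add J s).
Proof. exact: ideal_gen_is_ideal. Qed.

Lemma ideal_add_incl J s f : J f -> ideal_add J s f.
Proof. by move=> Jf; apply: ideal_gen_incl; left. Qed.
Arguments ideal_add_incl {J} s {f} _.

Lemma ideal_add_mem J s f : f \in s -> ideal_add J s f.
Proof. by move=> sf; apply: ideal_gen_incl; right. Qed.
Arguments ideal_add_mem J {s f} _.

Lemma ideal_add_sub J s L :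
  is_ideal L -> J `<=` L -> {in s, forall f, L f} -> ideal_add J s `<=` L.
Proof. by move=> hL JL sL; apply: ideal_gen_sub => // f [/JL|/sL]. Qed.

Lemma ideal_add_nil J : is_ideal J -> ideal_add J [::] = J.
Proof.
move=> hJ; apply/seteqP; split; last exact: ideal_add_incl.
exact: ideal_add_sub.
Qed.

Lemma ideal_add_consE J x s :
  ideal_add J (x :: s) = ideal_add (ideal_add J [:: x]) s.
Proof.
apply/seteqP; split.
  apply: ideal_add_sub; first exact: ideal_add_is_ideal.
    by move=> f Jf; do 2 apply: ideal_add_incl.
  move=> f; rewrite in_cons => /orP[/eqP->|sf]; last exact: ideal_add_mem.
  by apply: ideal_add_incl; apply: ideal_add_mem; rewrite mem_head.
apply: ideal_add_sub; first exact: ideal_add_is_ideal.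
  apply: ideal_add_sub; first exact: ideal_add_is_ideal.
    exact: ideal_add_incl.
  by move=> f; rewrite inE => /eqP->; apply: ideal_add_mem; rewrite mem_head.
by move=> f sf; apply: ideal_add_mem; rewrite in_cons sf orbT.
Qed.

Lemma ideal_add_swap J x y : ideal_add J [:: x; y] = ideal_add J [:: y; x].
Proof.
by congr (ideal_gen (_ `|` _)); apply/seteqP; split=> f /=; rewrite !inE orbC.
Qed.

(* Unification must not unfold the ideal into the intersection defining it. *)
Local Opaque ideal_add.

Lemma ideal_add1P J x f : is_ideal J ->
  ideal_add J [:: x] f <-> exists2 j, J j & exists c, f = j + c * x.
Proof.
move=> hJ; split=> [|[j Jj [c ->]]]; last first.
  apply: (idealD (ideal_add_is_ideal _ _)).
    by apply: ideal_add_incl.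
  apply: (idealMl _ (ideal_add_is_ideal _ _)).
  by apply: ideal_add_mem; rewrite mem_head.
pose L := [set g | exists2 j, J j & exists c, g = j + c * x].
apply: (@ideal_add_sub J [:: x] L) => [|{}f Jf|{}f].
- split=> [|{}f g [j Jj [c ->]] [j' Jj' [c' ->]]|{}f g [j Jj [c ->]]].
  + by exists 0; [exact: ideal0|exists 0; rewrite mul0r addr0].
  + by exists (j + j'); [exact: idealD|exists (c + c'); ring].
  + by exists (f * j); [exact: idealMl|exists (f * c); ring].
- by exists f => //; exists 0; rewrite mul0r addr0.
- rewrite inE => /eqP->; exists 0; first exact: ideal0.
  by exists 1; rewrite mul1r add0r.
Qed.

Lemma ideal_add_id J x : is_ideal J -> J x -> ideal_add J [:: x] = J.
Proof.
move=> hJ Jx; apply/seteqP; split; last exact: ideal_add_incl.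
by apply: ideal_add_sub => // f; rewrite inE => /eqP->.
Qed.

Lemma colon_is_ideal J x : is_ideal J -> is_ideal (colon J x).
Proof.
move=> hJ; split=> [|f g Jf Jg|f g Jg]; rewrite /colon /=.
- by rewrite mul0r; apply: ideal0.
- by rewrite mulrDl; apply: idealD.
- by rewrite -mulrA; apply: idealMl.
Qed.

Lemma colon_colon J x y : colon (colon J x) y = colon J (y * x).
Proof. by apply/seteqP; split=> f; rewrite /colon /= mulrA. Qed.

Lemma ass_colon J x : ass (colon J x) `<=` ass J.
Proof.
by move=> p [hp [f Ep]]; split=> //; exists (f * x); rewrite Ep colon_colon.
Qed.

Lemma prime_is_ideal p : is_prime_ideal p -> is_ideal p.
Proof. by case=> -[]. Qed.

Lemma prime_exp p f k : is_prime_ideal p -> p (f ^+ k) -> p f.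
Proof.
case=> -[hp np] pr; elim: k => [|k IH]; last by rewrite exprS => /pr[].
by rewrite expr0 => /np.
Qed.

(** * Regular sequences *)

(** The recursive form of regularity: discarding the head of the sequence is
    then an operation on the pair (ideal, sequence), and inductions may change
    the ideal. *)
Fixpoint weakly_regular J s : Prop :=
  if s is x :: s' then
    (forall g, J (x * g) -> J g) /\ weakly_regular (ideal_add J [:: x]) s'
  else True.

Lemma weakly_regularP J s : is_ideal J ->
  weakly_regular J s <->
  (forall j, (j < size s)%N -> forall g,
     ideal_add J (take j s) (s`_j * g) -> ideal_add J (take j s) g).
Proof.
elim: s J => [|x s IH] J hJ; first by split.
have hJx := ideal_add_is_ideal J [:: x].
split=> [[xJ /(IH _ hJx) reg] [|j] lt_j g /=|reg].
- by rewrite ideal_add_nil //; apply: xJ.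
- by rewrite ideal_add_consE; apply: reg.
split.
  by move=> g; have := reg 0%N isT g; rewrite /= ideal_add_nil.
apply/IH => // j lt_j g.
by rewrite -ideal_add_consE; apply: (reg j.+1).
Qed.

(** The short exact sequence 0 -> R/(J:y) -> R/J -> R/(J+y) -> 0: a sequence
    which is regular on both ends is regular in the middle.  The induction
    goes through because the first element of the sequence, being regular on
    R/(J+y), commutes with taking the colon by y. *)
Lemma weakly_regular_ext J y s : is_ideal J ->
  weakly_regular (colon J y) s -> weakly_regular (ideal_add J [:: y]) s ->
  weakly_regular J s.
Proof.
elim: s J => [//|t s IH] J hJ [tC regC] [tA regA].
have regJ g : J (t * g) -> J g.
  move=> Jtg; have /tA/ideal_add1P[//|j Jj [h Eg]] : ideal_add J [:: y] (t * g).
    by apply: ideal_add_incl.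
  rewrite Eg in Jtg *; apply: idealD => //; apply: tC; rewrite /colon /=.
  rewrite -mulrA; apply: (@idealDr _ (t * j)) => //; first exact: idealMl.
  by rewrite -mulrDr.
split=> //; apply: IH; first exact: ideal_add_is_ideal; last first.
  by rewrite -ideal_add_consE ideal_add_swap ideal_add_consE.
suff -> : colon (ideal_add J [:: t]) y = ideal_add (colon J y) [:: t] by [].
apply/seteqP; split=> h.
  rewrite {1}/colon /= => /ideal_add1P-/(_ hJ)[j Jj [c Eh]].
  have /tA/ideal_add1P[//|j' Jj' [e Ec]] : ideal_add J [:: y] (t * c).
    apply/ideal_add1P => //; exists (- j); first exact: idealN.
    by exists h; rewrite Eh; ring.
  apply/ideal_add1P; first exact: colon_is_ideal.
  exists (h - e * t); last by exists e; ring.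
  rewrite /colon /= mulrBl Eh Ec.
  rewrite (_ : _ - _ = j + j' * t); last by ring.
  by apply: idealD => //; apply: idealMr.
move=> /ideal_add1P-/(_ (colon_is_ideal y hJ))[j Jj [c ->]].
rewrite /colon /=; apply/ideal_add1P => //; exists (j * y) => //.
by exists (c * y); ring.
Qed.

(** Induction on the exponent by [weakly_regular_ext], with y = x: the colon of
    J + (x^(k+2)) by x is J + (x^(k+1)), and adding x gives J + (x). *)
Lemma weakly_regular_expr_head J x s k : is_ideal J ->
  (forall g, J (x * g) -> J g) -> weakly_regular (ideal_add J [:: x]) s ->
  weakly_regular (ideal_add J [:: x ^+ k.+1]) s.
Proof.
move=> hJ xJ reg; elim: k => [|k IH]; first by rewrite expr1.
apply: (@weakly_regular_ext _ x); first exact: ideal_add_is_ideal.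
  suff -> : colon (ideal_add J [:: x ^+ k.+2]) x = ideal_add J [:: x ^+ k.+1]
    by [].
  apply/seteqP; split=> h.
    rewrite /colon /= => /ideal_add1P-/(_ hJ)[j Jj [c Eh]].
    apply/ideal_add1P => //; exists (h - c * x ^+ k.+1).
      apply: xJ; rewrite (_ : _ * _ = j) // mulrBr mulrC Eh (exprS _ k.+1).
      by ring.
    by exists c; ring.
  move=> /ideal_add1P-/(_ hJ)[j Jj [c ->]]; apply/ideal_add1P => //.
  exists (j * x); first exact: idealMr.
  by exists c; rewrite (exprS _ k.+1); ring.
rewrite -ideal_add_consE ideal_add_swap ideal_add_consE ideal_add_id //.
  exact: ideal_add_is_ideal.
rewrite exprS; apply: (idealMr _ (ideal_add_is_ideal _ _)).
by apply: ideal_add_mem; rewrite mem_head.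
Qed.

Lemma weakly_regular_expr J s k : is_ideal J ->
  weakly_regular J s -> weakly_regular J [seq x ^+ k.+1 | x <- s].
Proof.
elim: s J => [//|x s IH] J hJ [xJ reg] /=; split.
  elim: k {IH} => [|k IH] g; first exact: xJ.
  by rewrite exprS -mulrA => /xJ/IH.
apply: IH; first exact: ideal_add_is_ideal.
exact: weakly_regular_expr_head.
Qed.

(** Regularity of x modulo J + (y): a relation x g = j + c y puts y c, hence c,
    into J + (x), and then x can be cancelled from the relation. *)
Lemma weakly_regular_swap J x y s : is_ideal J ->
  weakly_regular J (x :: y :: s) -> (forall g, J (y * g) -> J g) ->
  weakly_regular J (y :: x :: s).
Proof.
move=> hJ [xJ [yJ reg]] yJ'; split=> //; split; last first.
  by rewrite -ideal_add_consE ideal_add_swap ideal_add_consE.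
move=> g /ideal_add1P-/(_ hJ)[j Jj [c Eg]].
have /yJ/ideal_add1P[//|j' Jj' [e Ec]] : ideal_add J [:: x] (y * c).
  apply/ideal_add1P => //; exists (- j); first exact: idealN.
  by exists g; rewrite [g * x]mulrC Eg; ring.
apply/ideal_add1P => //; exists (g - e * y); last by exists e; ring.
apply: xJ; rewrite (_ : _ * _ = j + y * j').
  by apply: idealD => //; apply: idealMl.
by rewrite mulrBr Eg Ec; ring.
Qed.

(** * Algebraic relations with a distinguished lowest term *)

(** A value at [t] of a polynomial whose lexicographically lowest monomial has
    coefficient 1, written in Horner form with respect to that monomial; [g] in
    an ideal is an algebraic dependence of [t] modulo the ideal.  This
    is the shape of the constructive (Coquand-Lombardi) characterisation of
    Krull dimension. *)
Fixpoint lex_relation t g : Prop :=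
  if t is x :: t' then
    exists m a g', lex_relation t' g' /\ g = x ^+ m * (g' + a * x)
  else g = 1.

(** Cancelling successively the powers of the elements of [t] leaves the
    lowest coefficient, which is 1. *)
Lemma lex_relation_regular J t f g : is_ideal J ->
  weakly_regular J t -> lex_relation t g -> J (f * g) -> ideal_add J t f.
Proof.
elim: t J g => [|x t IH] J g hJ /=.
  by move=> _ ->; rewrite mulr1 ideal_add_nil.
move=> [xJ reg] [m [a [g' [rel ->]]]] Jfg.
rewrite ideal_add_consE; apply: IH reg rel _; first exact: ideal_add_is_ideal.
have : J (x ^+ m * (f * g' + f * a * x)).
  by rewrite (_ : _ * _ = f * (x ^+ m * (g' + a * x))) //; ring.
elim: m {Jfg} => [|m IHm]; last by rewrite exprS -mulrA => /xJ/IHm.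
rewrite expr0 mul1r => Jg; apply/ideal_add1P => //.
by exists (f * g' + f * a * x) => //; exists (- (f * a)); ring.
Qed.

(** The same cancellation along a chain of primes: each new element of the
    chain is invertible modulo the current prime, and vanishes modulo the next
    one. *)
Lemma lex_relation_chain (c : nat -> set R) h (x : nat -> R) t g :
  (forall i, (i <= h)%N -> is_prime_ideal (c i)) ->
  (forall i, (i < h)%N -> [/\ c i `<=` c i.+1, ~ c i (x i) & c i.+1 (x i)]) ->
  lex_relation (mkseq x h ++ t) g -> c 0%N g ->
  exists2 g', lex_relation t g' & c h g'.
Proof.
elim: h c x g => [|h IH] c x g pc cx /=; first by exists g.
move=> [m [a [g' [rel ->]]]] /(proj2 (pc 0%N isT)) cg.
have [sub nx cx0] := cx 0%N isT.
have c0g : c 0%N (g' + a * x 0%N).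
  by case: cg => // /(prime_exp (pc 0%N isT)).
apply: (IH (fun i => c i.+1) (fun i => x i.+1) g').
- by move=> i lt_i; apply: pc.
- by move=> i lt_i; apply: cx.
- move: rel; rewrite (_ : map _ _ = mkseq (fun i => x i.+1) h) //.
  by rewrite /mkseq -(addn0 1%N) iotaDl -map_comp.
- have hc1 := prime_is_ideal (pc 1%N isT).
  apply: (@idealDr _ (a * x 0%N)) => //; first exact: idealMl.
  by rewrite addrC; apply: sub.
Qed.

End IdealTheory.

Arguments ideal_gen_incl {R} A _ _.
Arguments ideal_add_incl {R J} s {f} _.
Arguments ideal_add_mem {R} J {s f} _.

Local Opaque ideal_add.

(** * Monomial ideals *)

Section MonomialIdeals.
Variables (K : fieldType) (n : nat).
Implicit Types (I J p : set {mpoly K[n]}) (f g x : {mpoly K[n]}).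
Implicit Types (m u : 'X_{1..n}) (A : {set 'I_n}) (s t : seq {mpoly K[n]}).

(** Stability under the Z^n-grading; equivalent to being generated by
    monomials, but without reference to generators. *)
Definition multigraded I : Prop :=
  is_ideal I /\ forall f m, I f -> m \in msupp f -> I 'X_[m].

Definition monomial_span (U : set 'X_{1..n}) : set {mpoly K[n]} :=
  [set f | forall m, m \in msupp f -> U m].

Lemma ideal_msupp I f :
  is_ideal I -> (forall m, m \in msupp f -> I 'X_[m]) -> I f.
Proof.
move=> hI If; rewrite (mpolyE f); apply: ideal_sum => // m /If Im.
by rewrite -mul_mpolyC; apply: idealMl.
Qed.

Lemma monomial_spanX (U : set 'X_{1..n}) m : monomial_span U 'X_[m] <-> U m.
Proof.
split=> [|Um k /mem_msuppXP <- //]; apply.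
by apply/mem_msuppXP.
Qed.

Lemma monomial_span_multigraded (U : set 'X_{1..n}) :
  (forall m m', U m -> U (m' + m)%MM) -> multigraded (monomial_span U).
Proof.
move=> upU; split=> [|f m Uf /Uf Um]; last exact/monomial_spanX.
split=> [m|f g Uf Ug m /msuppD_le|f g Ug m /msuppM_le].
- by rewrite msupp0.
- by rewrite mem_cat => /orP[/Uf|/Ug].
- by case/allpairsP=> -[m1 m2] [_ /Ug/upU hm ->]; apply: hm.
Qed.

Lemma is_monomial_ideal_multigraded I : is_monomial_ideal I -> multigraded I.
Proof.
case=> M EI; pose U : set 'X_{1..n} :=
  [set m | exists2 u, M u & exists m', m = (m' + u)%MM].
have grU : multigraded (monomial_span U).
  apply: monomial_span_multigraded => m m' [u Mu [m1 ->]].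
  by exists u => //; exists (m' + m1)%MM; rewrite addmA.
suff -> : I = monomial_span U by [].
rewrite EI; apply/seteqP; split.
  apply: ideal_gen_sub; first by case: grU.
  by move=> _ [u Mu <-]; apply/monomial_spanX; exists u => //; exists 0%MM;
    rewrite add0m.
move=> f Uf; apply: ideal_msupp; first exact: ideal_gen_is_ideal.
move=> m /Uf [u Mu [m' ->]]; rewrite mpolyXD.
apply: (idealMl _ (ideal_gen_is_ideal _)); apply: ideal_gen_incl.
by exists u.
Qed.

Lemma multigraded_colon I u : multigraded I -> multigraded (colon I 'X_[u]).
Proof.
move=> [hI grI]; split=> [|f m]; first exact: colon_is_ideal.
rewrite /colon /= -mpolyXD => /grI If fm; apply: If.
by rewrite (perm_mem (msuppMX _ _)) addmC map_f.
Qed.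

Lemma ideal_addX I u m : multigraded I ->
  ideal_add I [:: 'X_[u]] 'X_[m] <-> I 'X_[m] \/ exists m', m = (m' + u)%MM.
Proof.
move=> [hI grI]; split=> [/ideal_add1P-/(_ hI)[j Ij [c Em]]|].
  have : m \in msupp ('X_[m] : {mpoly K[n]}) by apply/mem_msuppXP.
  rewrite {1}Em => /msuppD_le; rewrite mem_cat => /orP[/grI Im|].
    by left; apply: Im.
  by rewrite (perm_mem (msuppMX _ _)) => /mapP[m' _ ->]; right; exists m';
    rewrite addmC.
case=> [Im|[m' ->]]; first exact: (ideal_add_incl _ Im).
rewrite mpolyXD; apply: (idealMl _ (ideal_add_is_ideal _ _)).
by apply: ideal_add_mem; rewrite mem_head.
Qed.

Lemma multigraded_add I u : multigraded I ->
  multigraded (ideal_add I [:: 'X_[u]]).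
Proof.
move=> gI; have [hI grI] := gI; split; first exact: ideal_add_is_ideal.
move=> f m /ideal_add1P-/(_ hI)[j Ij [c ->]] fm; apply/ideal_addX => //.
move: fm => /msuppD_le; rewrite mem_cat => /orP[/grI|]; first by left; auto.
by rewrite (perm_mem (msuppMX _ _)) => /mapP[m' _ ->]; right; exists m';
  rewrite addmC.
Qed.

Lemma prime_prod p (T : eqType) (r : seq T) (F : T -> {mpoly K[n]}) :
  is_prime_ideal p -> p (\prod_(i <- r) F i) -> exists2 i, i \in r & p (F i).
Proof.
move=> [[hp np] pr]; elim: r => [|i r IH]; first by rewrite big_nil.
rewrite big_cons => /pr[pi|/IH[j rj pj]]; first by exists i; rewrite ?mem_head.
by exists j; rewrite // in_cons rj orbT.
Qed.

Lemma prime_monomial p m :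
  is_prime_ideal p -> p 'X_[m] -> exists2 i, m i != 0%N & p 'X_i.
Proof.
move=> pp; rewrite mpolyXE_id => /(prime_prod pp)[i _ pi].
by exists i; [move: pi; case: (m i) => // /(proj2 (proj1 pp))|
              apply: prime_exp pi].
Qed.

(** ** Ideals generated by variables *)

Definition meets A m : bool := [exists i in A, m i != 0%N].

Definition var_ideal A : set {mpoly K[n]} := monomial_span (meets A).

Lemma meetsD A m m' : meets A (m + m')%MM = meets A m || meets A m'.
Proof.
apply/exists_inP/orP=> [[i iA]|[]/exists_inP[i iA nz]].
- rewrite mnmDE addn_eq0 negb_and => /orP[]nz; [left|right];
  by apply/exists_inP; exists i.
- by exists i => //; rewrite mnmDE addn_eq0 negb_and nz.
- by exists i => //; rewrite mnmDE addn_eq0 negb_and nz orbT.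
Qed.

Lemma meets0 A : meets A 0%MM = false.
Proof. by apply/exists_inP => -[i _]; rewrite mnm0E. Qed.

Lemma meetsU A i : meets A U_(i)%MM = (i \in A).
Proof.
apply/exists_inP/idP=> [[j jA]|iA]; last by exists i; rewrite // mnm1E eqxx.
by rewrite mnm1E eqb0 negbK => /eqP->.
Qed.

Lemma var_ideal_multigraded A : multigraded (var_ideal A).
Proof.
by apply: monomial_span_multigraded => m m'; rewrite meetsD => ->; rewrite orbT.
Qed.

Lemma var_ideal_is_ideal A : is_ideal (var_ideal A).
Proof. by case: (var_ideal_multigraded A). Qed.

Lemma var_idealX A m : var_ideal A 'X_[m] <-> meets A m.
Proof. exact: monomial_spanX. Qed.

Lemma var_idealP A f : var_ideal A f <-> forall m, ~~ meets A m -> f@_m = 0.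
Proof.
split=> Af m; last first.
  by apply: contraLR => /Af; rewrite mcoeff_msupp negbK => /eqP.
by move=> nm; apply/eqP; rewrite mcoeff_eq0; apply: contra nm => /Af.
Qed.

(** Every polynomial is congruent, modulo a variable ideal, to a polynomial in
    the other variables; the leading monomial of a product of such polynomials
    again involves only the other variables. *)
Lemma var_ideal_prime A : is_prime_ideal (var_ideal A).
Proof.
have hA := var_ideal_is_ideal A.
split.
  split=> // /(_ 0%MM); rewrite msupp1 mem_head meets0 => /(_ isT).
  by [].
pose r f : {mpoly K[n]} := \sum_(m <- msupp f | ~~ meets A m) f@_m *: 'X_[m].
have Ar f : var_ideal A (f - r f).
  rewrite {1}(mpolyE f) (bigID (meets A)) /= addrK -big_filter.
  apply: (ideal_sum hA) => m; rewrite mem_filter => /andP[mA _].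
  by rewrite -mul_mpolyC; apply: (idealMl _ hA); apply/var_idealX.
have rA f m : m \in msupp (r f) -> ~~ meets A m.
  move=> /msupp_sum_le/flattenP[S /mapP[k]].
  by rewrite mem_filter => /andP[kA _] -> /msuppZ_le/mem_msuppXP <-.
move=> f g Afg.
have [/eqP rf0|rf0] := boolP (r f == 0); first by left; rewrite -[f]subr0 -rf0.
have [/eqP rg0|rg0] := boolP (r g == 0); first by right; rewrite -[g]subr0 -rg0.
have : var_ideal A (r f * r g).
  rewrite (_ : _ * _ = f * g - (r f * (g - r g) + (f - r f) * g)); last by ring.
  apply: (idealB hA) => //.
  by apply: (idealD hA); [apply: (idealMl _ hA)|apply: (idealMr _ hA)].
have rfg0 : r f * r g != 0 by rewrite mulf_neq0.
move=> /(_ _ (mlead_supp rfg0)); rewrite mleadM // meetsD.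
by rewrite (negPf (rA _ _ (mlead_supp rf0))) (negPf (rA _ _ (mlead_supp rg0))).
Qed.

Lemma multigraded_primeE p : multigraded p -> is_prime_ideal p ->
  exists A, p = var_ideal A.
Proof.
move=> [hp grp] pp; exists [set i | `[< p 'X_i >]]%SET.
apply/seteqP; split=> f pf.
  move=> m fm; have [i mi pi] := prime_monomial pp (grp _ _ pf fm).
  by apply/exists_inP; exists i; rewrite // inE; apply/asboolP.
apply: ideal_msupp => // m /pf/exists_inP[i].
rewrite inE => /asboolP pi mi.
by rewrite mpolyXE_id (bigD1 i) //= -(prednK (n:=m i)) ?lt0n // exprS -mulrA;
  apply: idealMr.
Qed.

Lemma var_ideal_add A i :
  ideal_add (var_ideal A) [:: 'X_i] = var_ideal (i |: A)%SET.
Proof.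
have gA := var_ideal_multigraded A.
have gi := var_ideal_multigraded (i |: A)%SET.
have meetsU1 m : meets (i |: A)%SET m = (m i != 0%N) || meets A m.
  apply/exists_inP/orP=> [[j]|].
    rewrite !inE => /orP[/eqP->|jA mj]; [by left|right].
    by apply/exists_inP; exists j.
  case=> [mi|/exists_inP[j jA mj]]; first by exists i; rewrite // !inE eqxx.
  by exists j; rewrite // !inE jA orbT.
apply/seteqP; split=> f.
  move=> /(proj2 (multigraded_add U_(i)%MM gA)) fA m /fA/ideal_addX-/(_ gA).
  rewrite meetsU1 => -[/var_idealX->|[m' ->]]; first by rewrite orbT.
  by rewrite mnmDE mnm1E eqxx addn1.
move=> fA; apply: ideal_msupp; first exact: ideal_add_is_ideal.
move=> m /fA; rewrite meetsU1 => /orP[mi|mA]; apply/ideal_addX => //.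
  right; exists (m - U_(i))%MM; rewrite submK //; apply/mnm_lepP => j.
  by rewrite mnm1E; case: eqP => // <-; rewrite lt0n.
by left; apply/var_idealX.
Qed.

(** * Associated primes of monomial ideals *)

Lemma size_msupp_drop_lead f : f != 0 ->
  (size (msupp (f - f@_(mlead f) *: 'X_[mlead f])) < size (msupp f))%N.
Proof.
move=> f0; rewrite (perm_size (msupp_rem _ _)) size_rem ?mlead_supp //.
by have := mlead_supp f0; case: (msupp f).
Qed.

(** Leading terms can be removed one after the other. *)
Lemma lead_closed_multigraded p : is_ideal p ->
  (forall f, p f -> f != 0 -> p 'X_[mlead f]) -> multigraded p.
Proof.
move=> hp lead; split=> // f m.
have [k] := ubnP (size (msupp f)); elim: k f => // k IH f le_k pf fm.
have f0 : f != 0 by apply: contraTneq fm => ->; rewrite msupp0.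
have [->|ne] := eqVneq m (mlead f); first exact: lead.
pose f' := f - f@_(mlead f) *: 'X_[mlead f].
have Ef' := msupp_rem f (mlead f).
apply: (IH f').
- exact: leq_trans (size_msupp_drop_lead f0) _.
- apply: idealB => //; rewrite -mul_mpolyC; apply: idealMl => //.
  exact: lead.
- by rewrite (perm_mem Ef') mem_rem_uniq // inE /= ne.
Qed.

(** The product of the leading monomials is the leading monomial of g f, hence
    lies in I; so multiplication by the leading monomial of g kills the leading
    term of f modulo I, and f has finitely many terms. *)
Lemma mlead_expr_kills I f g : multigraded I -> g != 0 -> I (g * f) ->
  exists k, I ('X_[mlead g] ^+ k * f).
Proof.
move=> [hI grI] g0; have [N] := ubnP (size (msupp f)).
elim: N f => // N IH f le_N Igf.
have [->|f0] := eqVneq f 0; first by exists 0%N; rewrite mulr0; apply: ideal0.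
set l := mlead g; pose lt := f@_(mlead f) *: 'X_[mlead f] : {mpoly K[n]}.
have Ilt : I ('X_[l] * lt).
  rewrite -scalerAr -mul_mpolyC; apply: idealMl => //.
  rewrite -mpolyXD -mleadM //; apply: grI Igf _.
  by rewrite mlead_supp // mulf_neq0.
have [k Ik] : exists k, I ('X_[l] ^+ k * ((f - lt) * 'X_[l])).
  apply: IH.
    rewrite (perm_size (msuppMX _ _)) size_map.
    exact: leq_trans (size_msupp_drop_lead f0) _.
  rewrite (_ : g * _ = 'X_[l] * (g * f) - g * ('X_[l] * lt)); last by ring.
  by apply: idealB => //; apply: idealMl.
exists k.+1; rewrite (_ : _ * f =
  'X_[l] ^+ k * ((f - lt) * 'X_[l]) + 'X_[l] ^+ k * ('X_[l] * lt)).
  by apply: idealD => //; apply: idealMl.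
by rewrite exprSr; ring.
Qed.

Lemma ass_multigraded I p : multigraded I -> ass I p ->
  exists A, p = var_ideal A.
Proof.
move=> gI [pp [f Ep]]; apply: multigraded_primeE => //.
apply: lead_closed_multigraded; first exact: prime_is_ideal.
move=> g; rewrite {1}Ep => Ig g0; have [k Ik] := mlead_expr_kills gI g0 Ig.
by apply: (@prime_exp _ p _ k) => //; rewrite Ep.
Qed.

(** * Algebraic dependence *)

(** Lists rather than finite functions, so that sums over exponents can be
    handled by recursion on the sequence of polynomials. *)
Fixpoint exponents (N d : nat) : seq (seq nat) :=
  if d is d'.+1 then [seq k :: a | k <- iota 0 N, a <- exponents N d']
  else [:: [::]].

Fixpoint power_product t (a : seq nat) : {mpoly K[n]} :=
  if t is x :: t' then x ^+ head 0%N a * power_product t' (behead a) else 1.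

Lemma size_exponents N d : size (exponents N d) = (N ^ d)%N.
Proof.
by elim: d => //= d IH; rewrite size_allpairs size_iota IH expnS.
Qed.

Lemma uniq_exponents N d : uniq (exponents N d).
Proof.
elim: d => //= d IH; apply: allpairs_uniq => //; first exact: iota_uniq.
by move=> [k a] [k' a'] _ _ /= [-> ->].
Qed.

(** The lowest power of the first letter is factored out, and the induction
    continues with its coefficient. *)
Lemma lex_relation_of_sum t N (v : seq nat -> K) :
  (exists2 a, a \in exponents N (size t) & v a != 0) ->
  exists c g, [/\ c != 0, lex_relation t g &
    \sum_(a <- exponents N (size t)) v a *: power_product t a = c *: g].
Proof.
elim: t v => [|x t IH] v /=.
  move=> [a]; rewrite inE => /eqP-> v0; exists (v [::]), 1.
  by rewrite big_seq1.
move=> [_ /allpairsP[[k0 a0] /= [k0N a0E ->]] v0].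
have exk : exists k, (k < N)%N &&
    has (fun a => v (k :: a) != 0) (exponents N (size t)).
  exists k0; move: k0N; rewrite mem_iota add0n => /= ->.
  by apply/hasP; exists a0.
case: (ex_minnP exk) => k /andP[kN /hasP[a aE va]] min_k {k0 a0 k0N a0E v0 exk}.
have [|c [g [c0 rel Eg]]] := IH (fun a => v (k :: a)); first by exists a.
pose S j := \sum_(a <- exponents N (size t)) v (j :: a) *: power_product t a.
have -> : \sum_(a <- [seq k :: a | k <- iota 0 N, a <- exponents N (size t)])
    v a *: (x ^+ head 0%N a * power_product t (behead a))
    = \sum_(j <- iota 0 N) x ^+ j * S j.
  rewrite big_allpairs_dep; apply: eq_bigr => j _; rewrite big_distrr /=.
  by apply: eq_bigr => b _; rewrite scalerAr.
have EN : iota 0 N = iota 0 k ++ k :: iota k.+1 (N - k.+1).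
  by rewrite -[k :: _]/(iota k (N - k.+1).+1) -iotaD; congr iota; lia.
pose Q := \sum_(j <- iota k.+1 (N - k.+1)) x ^+ (j - k.+1) * S j.
exists c, (x ^+ k * (g + (c^-1 *: Q) * x)); split=> //.
  by exists k, (c^-1 *: Q), g.
have S0 j : (j < k)%N -> S j = 0.
  move=> lt_jk; rewrite /S big_seq big1 // => b bE.
  have [->|vb] := eqVneq (v (j :: b)) 0; first exact: scale0r.
  suff : (k <= j)%N by rewrite leqNgt lt_jk.
  by apply: min_k; rewrite (ltn_trans lt_jk kN) /=; apply/hasP; exists b.
have -> : \sum_(j <- iota 0 N) x ^+ j * S j = x ^+ k * S k + x ^+ k * (Q * x).
  rewrite EN big_cat big_cons /= [X in X + _]big_seq [X in X + _]big1 ?add0r.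
    congr (_ + _); rewrite /Q big_distrl big_distrr big_seq [RHS]big_seq.
    apply: eq_bigr => j; rewrite mem_iota => /andP[le_j _].
    by rewrite -{1}(subnKC le_j) exprD exprSr /=; ring.
  by move=> j; rewrite mem_iota add0n => /andP[_ /S0->]; rewrite mulr0.
by rewrite [S k]Eg -mulrDr scalerAr scalerDr scalerAl scalerA mulfV // scale1r.
Qed.

Definition mdeg_bounded (M : nat) f :=
  forall m, m \in msupp f -> (mdeg m <= M)%N.

Lemma mdeg_boundedM M1 M2 f g :
  mdeg_bounded M1 f -> mdeg_bounded M2 g -> mdeg_bounded (M1 + M2) (f * g).
Proof.
move=> hf hg m /msuppM_le/allpairsP[[m1 m2] /= [/hf h1 /hg h2 ->]].
by rewrite mdegD leq_add.
Qed.

Lemma mdeg_bounded1 : mdeg_bounded 0 1.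
Proof. by move=> m; rewrite msupp1 inE => /eqP->; rewrite mdeg0. Qed.

Lemma mdeg_boundedW M1 M2 f :
  (M1 <= M2)%N -> mdeg_bounded M1 f -> mdeg_bounded M2 f.
Proof. by move=> le_M hf m /hf/leq_trans; apply. Qed.

Lemma mdeg_bounded_power_product t (N D : nat) a :
  {in t, forall x, mdeg_bounded D x} -> a \in exponents N (size t) ->
  mdeg_bounded (size t * (N * D)) (power_product t a).
Proof.
elim: t a => [|x t IH] a hD /=; first by move=> _; apply: mdeg_bounded1.
case/allpairsP=> -[k b] /= [kN bE ->] /=; rewrite mulSn.
apply: mdeg_boundedM; last first.
  by apply: IH => // y yt; apply: hD; rewrite in_cons yt orbT.
have : (k <= N)%N by move: kN; rewrite mem_iota => /andP[_ /ltnW].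
move=> le_k; apply: (@mdeg_boundedW (k * D)).
  by rewrite leq_mul2r le_k orbT.
elim: k {kN le_k b bE} => [|k IHk]; first exact: mdeg_bounded1.
by rewrite exprS mulSn; apply: mdeg_boundedM => //; apply: hD; rewrite mem_head.
Qed.

(** There are more monomials in the letters, with exponents below a large N,
    than there are monomials in the n - |A| variables outside A of the degrees
    that occur in their values; hence a linear relation between these values
    modulo the variables of A. *)
Lemma algebraic_dependence A t : (n - #|A| < size t)%N ->
  exists2 g, lex_relation t g & var_ideal A g.
Proof.
set d := size t => lt_d; pose q := #|~: A|.
have lt_qd : (q < d)%N.
  by have := cardsC A; rewrite card_ord -/q; lia.
pose D := \max_(x <- t) msize x.
have hD : {in t, forall x, mdeg_bounded D x}.
  move=> x xt m /msize_mdeg_lt/ltnW/leq_trans; apply.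
  by rewrite /D (big_rem x) //= leq_maxl.
(* All values have degree at most M, hence at most (M + 1)^q monomials occur,
   and M + 1 <= N (d D + 1); this N makes N^d > (N (d D + 1))^q. *)
pose N := ((d * D).+1 ^ q).+1; pose M := (d * (N * D))%N.
pose L := exponents N d.
pose C := [pred f : {ffun 'I_n -> 'I_M.+1} | f \in pffun_on ord0 (~: A) predT].
have cardC : #|C| = (M.+1 ^ q)%N.
  by rewrite card_pffun_on card_ord.
have lt_CL : (#|C| < size L)%N.
  rewrite cardC size_exponents -/d.
  apply: (@leq_ltn_trans ((N * (d * D).+1) ^ q)).
    have le_M : (M.+1 <= N * (d * D).+1)%N by rewrite /M; nia.
    by case: (q) => // e; rewrite leq_exp2r.
  apply: (@leq_trans (N ^ q.+1)); last by rewrite leq_pexp2l.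
  by rewrite expnMn expnSr ltn_pmul2l ?expn_gt0 // ltnS.
pose mon (f : {ffun 'I_n -> 'I_M.+1}) := [multinom (f i : nat) | i < n].
pose E : 'M[K]_(size L, #|C|) :=
  \matrix_(i, j) (power_product t (nth [::] L i))@_(mon (enum_val j)).
have [i0 row_nz] : exists i, row i (kermx E) != 0.
  apply/existsP; rewrite -negb_forall; apply/negP => /forallP ker0.
  have : kermx E == 0.
    by apply/eqP/row_matrixP => i; rewrite (eqP (ker0 i)) row0.
  rewrite kermx_eq0 /row_free => /eqP rkE.
  by have := rank_leq_col E; rewrite rkE leqNgt lt_CL.
set w := row i0 (kermx E) in row_nz.
have wE : w *m E = 0 by rewrite -row_mul mulmx_ker row0.
clearbody w.
pose v a := if insub (index a L) is Some i then w 0 i else 0.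
have vL (i : 'I_(size L)) : v (nth [::] L i) = w 0 i.
  by rewrite /v index_uniq ?uniq_exponents // valK.
have [|c [g [c0 rel Eg]]] := @lex_relation_of_sum t N v.
  have [i wi] : exists i, w 0 i != 0.
    apply/existsP; rewrite -negb_forall; apply: contraNN row_nz => /forallP w0.
    by apply/eqP/rowP => i; rewrite (eqP (w0 i)) mxE.
  by exists (nth [::] L i); rewrite ?mem_nth // vL.
exists g => //.
suff : var_ideal A (c *: g).
  move=> /(idealMl c^-1%:MP (var_ideal_is_ideal A)).
  by rewrite mul_mpolyC scalerA mulVf // scale1r.
rewrite -{}Eg; apply/var_idealP => m mA.
have [m_le|] := boolP [forall i, (m i <= M)%N]; last first.
  rewrite negb_forall => /existsP[i]; rewrite -ltnNge => lt_i.
  rewrite raddf_sum /= big_seq big1 // => a aE; rewrite mcoeffZ.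
  rewrite (memN_msupp_eq0 (m := m)) ?mulr0 //.
  apply/negP => /(mdeg_bounded_power_product hD aE); rewrite -/d -/M leqNgt.
  by rewrite (leq_trans lt_i) // mdegE (bigD1 i) //= leq_addr.
pose f : {ffun 'I_n -> 'I_M.+1} := [ffun i => inord (m i)].
have fC : f \in C.
  apply/pffun_onP; split=> //; apply/fintype.subsetP => i.
  rewrite !inE ffunE -val_eqE /= inordK ?ltnS; last exact: (forallP m_le).
  apply: contraNN => iA; apply: contraNT mA => mi.
  by apply/exists_inP; exists i.
have Em : mon f = m.
  by apply/mnmP => i; rewrite mnmE ffunE inordK // ltnS (forallP m_le).
rewrite raddf_sum (big_nth [::]) big_mkord /=.
have := congr1 (fun X : 'rV_#|C| => X 0 (enum_rank_in fC f)) wE.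
rewrite !mxE => wE0; rewrite -[RHS]wE0; apply: eq_bigr => i _.
by rewrite mcoeffZ vL mxE enum_rankK_in // Em.
Qed.

(** * A common regular sequence *)

Definition homogeneous_ideal I : Prop :=
  is_ideal I /\ forall f d, I f -> I (pihomog mdeg d f).

Lemma multigraded_homogeneous I : multigraded I -> homogeneous_ideal I.
Proof.
move=> [hI grI]; split=> // f d If; apply: ideal_msupp => // m.
move=> /msupp_sum_le/flattenP[S /mapP[k]]; rewrite mem_filter.
by move=> /andP[_ kf] -> /msuppZ_le/mem_msuppXP <-; apply: grI kf.
Qed.

Lemma pihomogM d e c x : x \is d.-homog for mdeg ->
  exists c', pihomog mdeg e (c * x) = c' * x.
Proof.
move=> hx; rewrite [c in c * x](pihomog_partitionE (mf := mdeg) (leqnn _)).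
rewrite mulr_suml linear_sum /=.
apply: (big_ind (fun y => exists c', y = c' * x)).
- by exists 0; rewrite mul0r.
- by move=> _ _ [c1 ->] [c2 ->]; exists (c1 + c2); rewrite mulrDl.
move=> k _; have hk := dhomogM (pihomogP mdeg k c) hx.
have [Ee|ne] := eqVneq (k + d)%N e.
  by exists (pihomog mdeg k c); rewrite pihomog_dE -?Ee.
by exists 0; rewrite mul0r (pihomog_ne0 ne).
Qed.

Lemma pihomogM_small d e c x : x \is d.-homog for mdeg -> (e < d)%N ->
  pihomog mdeg e (c * x) = 0.
Proof.
move=> /dhomogP hx lt_ed; rewrite pihomogE big_seq_cond big1 // => m.
case/andP=> /msuppM_le/allpairsP[[m1 m2] /= [_ /hx Em2 ->]].
by rewrite mdegD Em2 => /eqP Ee; move: lt_ed; rewrite -Ee ltnNge leq_addl.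
Qed.

Lemma homogeneous_ideal_add I d x : homogeneous_ideal I ->
  x \is d.-homog for mdeg -> homogeneous_ideal (ideal_add I [:: x]).
Proof.
move=> [hI grI] hx; split; first exact: ideal_add_is_ideal.
move=> f e /ideal_add1P-/(_ hI)[j Ij [c ->]]; apply/ideal_add1P => //.
rewrite pihomogD; have [c' ->] := pihomogM e c hx.
by exists (pihomog mdeg e j); [apply: grI|exists c'].
Qed.

(** Krull's intersection theorem in the graded case, by degrees. *)
Lemma homogeneous_separated I d x g : homogeneous_ideal I ->
  x \is d.+1.-homog for mdeg ->
  (forall k, ideal_add I [:: x ^+ k] g) -> I g.
Proof.
move=> [hI grI] hx xg.
suff Ig e : I (pihomog mdeg e g).
  rewrite (pihomog_partitionE (mf := mdeg) (leqnn (msize g))).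
  exact: ideal_sum.
have /ideal_add1P-/(_ hI)[j Ij [c ->]] := xg e.+1.
rewrite pihomogD (pihomogM_small (d := (d.+1 * e.+1)%N)) ?addr0.
- exact: grI.
- exact: dhomogMn.
- by rewrite mulSn leq_addr.
Qed.

(** By Krull's theorem the second element is regular on R/I, hence can be moved
    to the front of the sequence; the induction then drops x further down. *)
Lemma weakly_regular_behead I d x s : homogeneous_ideal I ->
  x \is d.+1.-homog for mdeg ->
  {in s, forall y, exists e, y \is e.-homog for mdeg} ->
  weakly_regular I (x :: s) -> weakly_regular I s.
Proof.
move=> + hx; elim: s I => [//|y s IH] I gI hs reg; have [hI _] := gI.
have [e hy] : exists e, y \is e.-homog for mdeg by apply: hs; rewrite mem_head.
have [xI [yIx _]] := reg.
have yI g : I (y * g) -> I g.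
  move=> Iyg; apply: (homogeneous_separated gI hx) => k.
  elim: k => [|k /ideal_add1P-/(_ hI)[j Ij [c Eg]]].
    by apply: (ideal_full _ (ideal_add_is_ideal _ _));
      apply: ideal_add_mem; rewrite expr0 mem_head.
  have : I (x ^+ k * (y * c)).
    rewrite (_ : _ * _ = y * g - y * j); last by rewrite Eg; ring.
    by apply: idealB => //; apply: idealMl.
  have xkI h : I (x ^+ k * h) -> I h.
    elim: k {Eg} => [|k IHk]; first by rewrite expr0 mul1r.
    by rewrite exprS -mulrA => /xI/IHk.
  move=> /xkI/(ideal_add_incl [:: x])/yIx/ideal_add1P-/(_ hI)[j' Ij' [c' Ec]].
  apply/ideal_add1P => //; exists (j + j' * x ^+ k).
    by apply: idealD => //; apply: idealMr.
  by exists c'; rewrite Eg Ec exprS; ring.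
have [_ reg'] := weakly_regular_swap hI reg yI.
split=> //; apply: (IH _ _ _ reg').
  exact: homogeneous_ideal_add hy.
by move=> z zs; apply: hs; rewrite in_cons zs orbT.
Qed.

(** The highest degree comes first: modulo n - r variables, the polynomial of
    degree r is the product of the remaining ones. *)
Fixpoint sym_seq (r : nat) : seq {mpoly K[n]} :=
  if r is r'.+1 then mesym n K r :: sym_seq r' else [::].

Lemma size_sym_seq r : size (sym_seq r) = r.
Proof. by elim: r => //= r ->. Qed.

Lemma sym_seq_homog r :
  {in sym_seq r, forall y, exists e, y \is e.+1.-homog for mdeg}.
Proof.
elim: r => //= r IH y; rewrite in_cons => /orP[/eqP->|/IH //].
by exists r; apply: dhomog_mesym.
Qed.

(** The complement of A is the only set of its size that does not meet A. *)
Lemma mesym_var_ideal A : exists2 j, var_ideal A j &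
  mesym n K #|~: A| = j + 'X_[mesym1 (~: A)].
Proof.
exists (mesym n K #|~: A| - 'X_[mesym1 (~: A)]); last by rewrite subrK.
rewrite mesymE (bigD1 (~: A)) //= addrAC subrr add0r.
rewrite big_seq_cond; apply: (big_ind (var_ideal A)).
- exact: (ideal0 (var_ideal_is_ideal A)).
- by move=> f g; apply: (idealD (var_ideal_is_ideal A)).
move=> h /and3P[_ /eqP cardh hA]; apply/var_idealX.
have : ~~ (h \subset ~: A).
  by apply: contra hA => sub; rewrite eqEcard sub cardh leqnn.
case/fintype.subsetPn=> i ih; rewrite inE negbK => iA.
by apply/exists_inP; exists i; rewrite // mnmE ih.
Qed.

(** When |A| = n - r the first polynomial is, modulo the variables of A, the
    product of the other variables, and [weakly_regular_ext] reduces to r - 1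
    polynomials modulo |A| + 1 variables.  When |A| < n - r, a further variable
    may be put at the head of the sequence, and dropped afterwards. *)
Lemma weakly_regular_sym_seq r A :
  (r + #|A| <= n)%N -> weakly_regular (var_ideal A) (sym_seq r).
Proof.
elim: r A => [//|r IHr] A.
have [k] := ubnP (n - #|A|); elim: k A => // k IHk A lt_k le_n.
have [hA _] := var_ideal_multigraded A.
have pA := var_ideal_prime A.
have := cardsC A; rewrite card_ord => cardA.
have [lt_n|ge_n] := ltnP (r.+1 + #|A|) n.
  have [i iA] : exists i, i \in ~: A by apply/card_gt0P; lia.
  have cardiA : #|i |: A| = #|A|.+1.
    by rewrite inE in iA; rewrite cardsU1 iA.
  apply: (@weakly_regular_behead _ 0 'X_i).
  - exact/multigraded_homogeneous/var_ideal_multigraded.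
  - by rewrite dhomogX /= mdeg1.
  - by move=> y /sym_seq_homog[e he]; exists e.+1.
  split; last by rewrite var_ideal_add; apply: IHk; rewrite cardiA; lia.
  move=> g /(proj2 pA)[] // /var_idealX; rewrite meetsU.
  by rewrite inE in iA; rewrite (negPf iA).
have Er : r.+1 = #|~: A| by lia.
have [j Aj Ee] := mesym_var_ideal A; rewrite -Er in Ee.
split.
  move=> g /(proj2 pA)[] //; rewrite Ee => /(idealDr hA Aj)/var_idealX.
  by case/exists_inP=> i iA; rewrite mnmE inE iA.
have -> : ideal_add (var_ideal A) [:: mesym n K r.+1]
        = ideal_add (var_ideal A) [:: 'X_[mesym1 (~: A)]].
  apply/seteqP; split=> f /ideal_add1P-/(_ hA)[j1 Aj1 [c ->]];
    apply/ideal_add1P => //.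
    exists (j1 + c * j); last by exists c; rewrite Ee; ring.
    by apply: (idealD hA) => //; apply: (idealMl _ hA).
  exists (j1 - c * j); last by exists c; rewrite Ee; ring.
  by apply: (idealB hA) => //; apply: (idealMl _ hA).
(* The variables of a product are split off one at a time: modulo A, the
   colon by a new variable gives back the shorter product, and the sum with it
   is an ideal of |A| + 1 variables. *)
have prodE : 'X_[mesym1 (~: A)] = \prod_(i <- enum (~: A)) 'X_i :> {mpoly K[n]}.
  rewrite big_enum mprodXE; congr 'X_[_]; apply/mnmP => i.
  rewrite mnmE mnm_sumE; case: (boolP (i \in ~: A)) => [iA|iA].
    rewrite (bigD1 i) //= mnm1E eqxx big1 // => l /andP[_ ne].
    by rewrite mnm1E (negPf ne).
  rewrite big1 // => l lA; rewrite mnm1E; case: eqP => // Eli.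
  by rewrite -Eli lA in iA.
rewrite prodE.
have : {subset enum (~: A) <= ~: A} by move=> i; rewrite mem_enum.
elim: (enum _) => [|i e IHe] sub_e.
  rewrite big_nil (_ : ideal_add _ _ = setT); last first.
    apply/seteqP; split=> // f _.
    apply: (ideal_full _ (ideal_add_is_ideal _ _)).
    by apply: ideal_add_mem; rewrite mem_head.
  suff full (I : set {mpoly K[n]}) s : I = setT -> weakly_regular I s.
    exact: full.
  elim: s I => //= x s IHs I EI; split; first by rewrite EI.
  by apply: IHs; rewrite EI ideal_add_id.
have iA : i \notin A by have := sub_e i; rewrite mem_head inE; apply.
have hP := ideal_add_is_ideal (var_ideal A) [:: \prod_(l <- i :: e) 'X_l].
apply: (@weakly_regular_ext _ _ 'X_i) => //.
  have -> : colon (ideal_add (var_ideal A) [:: \prod_(l <- i :: e) 'X_l]) 'X_i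
          = ideal_add (var_ideal A) [:: \prod_(l <- e) 'X_l].
    rewrite big_cons; apply/seteqP; split=> f.
      rewrite /colon /= => /ideal_add1P-/(_ hA)[j1 Aj1 [c Ef]].
      apply/ideal_add1P => //; exists (f - c * \prod_(l <- e) 'X_l).
        have : var_ideal A ((f - c * \prod_(l <- e) 'X_l) * 'X_i).
          by rewrite mulrBl Ef (_ : _ - _ = j1) //; ring.
        by move=> /(proj2 pA)[] // /var_idealX; rewrite meetsU (negPf iA).
      by exists c; ring.
    move=> /ideal_add1P-/(_ hA)[j1 Aj1 [c ->]]; apply/ideal_add1P => //.
    exists (j1 * 'X_i); first exact: (idealMr _ hA).
    by exists c; ring.
  by apply: IHe => l le; apply: sub_e; rewrite in_cons le orbT.
rewrite -ideal_add_consE ideal_add_swap ideal_add_consE var_ideal_add.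
rewrite ideal_add_id; first by apply: IHr; rewrite cardsU1 iA; lia.
  exact: var_ideal_is_ideal.
rewrite big_cons; apply: (idealMr _ (var_ideal_is_ideal _)).
by apply/var_idealX; rewrite meetsU !inE eqxx.
Qed.

(** * Primary monomial ideals *)

(** The quotient of R by a monomial ideal primary to the ideal of the variables
    in [A] has a finite filtration with all factors isomorphic to
    R/var_ideal A.  Splitting off the multiplication by a variable of A lowers
    the exponents of the pure powers known to lie in the ideal. *)
Lemma primary_filtration A I (a : 'I_n -> nat) :
  multigraded I -> ~ I 1 ->
  (forall i, i \in A -> I ('X_i ^+ (a i).+1)) ->
  (forall i m, i \notin A -> I 'X_[m + U_(i)] -> I 'X_[m]) ->
  ass I (var_ideal A) /\
  forall s, weakly_regular (var_ideal A) s -> weakly_regular I s.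
Proof.
have [k] := ubnP (\sum_(i in A) a i).
elim: k I a => // k IH I a le_k gI I1 Ia In.
have [hI grI] := gI.
have [/exists_inP[i iA ai]|a0] := boolP [exists i in A, a i != 0%N]; last first.
  suff -> : I = var_ideal A.
    split=> //; split; first exact: var_ideal_prime.
    by exists 1; apply/seteqP; split=> f; rewrite /colon /= mulr1.
  apply/seteqP; split=> f; last first.
    move=> fA; apply: ideal_msupp => // m /fA/exists_inP[i iA mi].
    have ai0 : a i = 0%N.
      by apply/eqP; apply: contraNT a0 => ai; apply/exists_inP; exists i.
    have := Ia i iA; rewrite ai0 expr1 => Ii; rewrite mpolyXE_id (bigD1 i) //=.
    by rewrite -(prednK (n := m i)) ?lt0n // exprS -mulrA; apply: idealMr.
  move=> If m /(grI _ _ If); have [N] := ubnP (mdeg m).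
  elim: N m => // N IHN m le_N Im.
  have [/eqP m0|m0] := boolP (m == 0%MM); first by rewrite m0 mpolyX0 in Im.
  have [i mi] : exists i, m i != 0%N.
    apply/existsP; apply: contraNT m0; rewrite negb_exists => /forallP m0.
    by apply/eqP/mnmP => i; rewrite mnm0E; apply/eqP; rewrite -[_ == _]negbK m0.
  have [iA|iA] := boolP (i \in A); first by apply/exists_inP; exists i.
  have Em : m = (m - U_(i) + U_(i))%MM.
    rewrite submK //; apply/mnm_lepP => j.
    by rewrite mnm1E; case: eqP => // <-; rewrite lt0n.
  rewrite Em in Im *; rewrite meetsD (IHN (m - U_(i))%MM) //; last exact: In Im.
  by rewrite Em mdegD mdeg1 addn1 in le_N.
pose a' b j := if j == i then b else a j.
have sum_a' b : (b < a i)%N -> (\sum_(j in A) a' b j < k)%N.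
  move=> lt_b; apply: (@leq_trans (\sum_(j in A) a j)); last by rewrite -ltnS.
  rewrite (bigD1 i) //= [X in (_ < X)%N](bigD1 i) //=.
  rewrite {1}/a' eqxx -addSn leq_add // leq_sum // => j /andP[_ ne].
  by rewrite /a' (negPf ne).
have [Ii|nIi] := pselect (I 'X_i).
  apply: (IH I (a' 0%N)); rewrite ?sum_a' ?lt0n // => j jA.
  by rewrite /a'; case: eqP => [->|_]; [rewrite expr1|apply: Ia].
have gC := multigraded_colon U_(i)%MM gI.
have gS := multigraded_add U_(i)%MM gI.
have [ass_C reg_C] : ass (colon I 'X_i) (var_ideal A) /\
    forall s, weakly_regular (var_ideal A) s -> weakly_regular (colon I 'X_i) s.
  apply: (IH _ (a' (a i).-1)) => //; first by rewrite sum_a' // prednK ?lt0n.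
  - by rewrite /colon /= mul1r.
  - move=> j jA; rewrite /colon /= /a'; case: eqP => [->|_].
      by rewrite prednK ?lt0n // -exprSr; apply: Ia.
    by apply: idealMr => //; apply: Ia.
  - move=> j m jA; rewrite /colon /= -!mpolyXD.
    by rewrite -addmA [(U_(j) + _)%MM]addmC addmA; apply: In.
split=> [|s reg_s]; first exact: ass_colon ass_C.
apply: (@weakly_regular_ext _ _ 'X_i) => //; first exact: reg_C.
apply: (proj2 (IH _ (a' 0%N) _ gS _ _ _)) => //.
- by rewrite sum_a' ?lt0n.
- rewrite -mpolyX0 => /ideal_addX-/(_ gI)[|[m' E0]]; first by rewrite mpolyX0.
  move/(congr1 (fun m : 'X_{1..n} => m i)): E0.
  by rewrite mnm0E mnmDE mnm1E eqxx addn1.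
- move=> j jA; rewrite /a'; case: eqP => [->|_].
    by apply: ideal_add_mem; rewrite expr1 mem_head.
  by apply: ideal_add_incl; apply: Ia.
move=> j m jA /ideal_addX-/(_ gI)[/In Im|[m' Em]]; apply/ideal_addX => //.
  by left; apply: Im.
right; exists (m - U_(i))%MM; rewrite submK //; apply/mnm_lepP => l.
rewrite mnm1E; case: eqP => // <-.
have nji : j != i by apply: contraNneq jA => ->.
move/(congr1 (fun m : 'X_{1..n} => m i)): Em.
by rewrite !mnmDE !mnm1E eqxx (negPf nji) addn0 addn1 => ->.
Qed.

(** Primarity says that the variables outside the radical can be cancelled, and
    each of the others has a power in the ideal. *)
Lemma primary_var_ideal I : multigraded I -> is_primary_ideal I ->
  exists2 A, ass I (var_ideal A) &
    forall s, weakly_regular (var_ideal A) s -> weakly_regular I s.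
Proof.
move=> gI [[_ I1] prim].
pose A : {set 'I_n} := [set i | `[< radical I 'X_i >]]%SET.
have /choice[a Ia] i : exists b, i \in A -> I ('X_i ^+ b.+1).
  have [|_] := boolP (i \in A); last by exists 0%N.
  rewrite inE => /asboolP[b Ib]; exists b => _; rewrite exprS.
  by apply: idealMl => //; case: gI.
have [|ass_I reg_I] := primary_filtration gI I1 Ia; last by exists A.
move=> i m iA; rewrite mpolyXD => /prim[//|radi].
by move: iA; rewrite inE => /asboolP.
Qed.

(** * Depth and height *)

Local Notation maxideal := (graded_max_ideal K n).

Lemma graded_max_idealE : maxideal = var_ideal [set: 'I_n].
Proof.
have hm : is_ideal maxideal := ideal_gen_is_ideal _.
apply/seteqP; split.
  apply: ideal_gen_sub; first exact: var_ideal_is_ideal.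
  by move=> _ [i _ <-]; apply/var_idealX; rewrite meetsU inE.
move=> f fm; apply: ideal_msupp => // m /fm/exists_inP[i _ mi].
rewrite mpolyXE_id (bigD1 i) //= -(prednK (n := m i)) ?lt0n // exprS -mulrA.
apply: (idealMr _ hm); apply: ideal_gen_incl.
by exists i.
Qed.

Lemma sym_seq_maxideal r : {in sym_seq r, forall f, maxideal f}.
Proof.
move=> f /sym_seq_homog[e /dhomogP hf]; rewrite graded_max_idealE => m /hf Em.
have : m != 0%MM by rewrite -mdeg_eq0 Em.
apply: contraR => /exists_inP m0; apply/eqP/mnmP => i; rewrite mnm0E.
by apply/eqP; apply: contra_notT m0 => mi; exists i; rewrite ?inE.
Qed.

Lemma maxideal_add_proper I s : multigraded I -> ~ I 1 ->
  {in s, forall f, maxideal f} -> ~ ideal_add I s 1.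
Proof.
move=> [hI grI] I1 sm; suff sub : ideal_add I s `<=` var_ideal [set: 'I_n].
  by move=> /sub; case: (var_ideal_prime [set: 'I_n]) => -[].
apply: ideal_add_sub; first exact: var_ideal_is_ideal.
  move=> f If m /(grI _ _ If) Im; apply: contra_notT I1 => m0.
  suff Em : m = 0%MM by rewrite -mpolyX0 -Em.
  apply/mnmP => i; rewrite mnm0E; apply/eqP; apply: contraNT m0 => mi.
  by apply/exists_inP; exists i; rewrite ?inE.
by move=> f /sm; rewrite graded_max_idealE.
Qed.

Lemma maxideal_expr f k m :
  maxideal f -> m \in msupp (f ^+ k) -> (k <= mdeg m)%N.
Proof.
rewrite graded_max_idealE => fm; elim: k m => // k IH m.
rewrite exprS => /msuppM_le/allpairsP[[m1 m2] /=].
case=> /fm/exists_inP[i _ m1i] /IH le2 ->.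
rewrite mdegD -add1n leq_add // mdegE (bigD1 i) //=.
by rewrite (leq_trans _ (leq_addr _ _)) // lt0n.
Qed.

(** Let f span a copy of R/var_ideal A in R/I.  If s were longer than the
    Krull dimension of R/var_ideal A, some relation between (powers of) its
    elements would kill f, and cancelling would put f in I + (s).  Using large
    powers, f is in I + m^N for all N, hence in I. *)
Lemma regular_length_le I A s : multigraded I -> ass I (var_ideal A) ->
  {in s, forall f, maxideal f} -> weakly_regular I s -> (size s <= n - #|A|)%N.
Proof.
move=> gI [[[_ A1] _] [f Ef]] sm reg; have [hI grI] := gI.
rewrite leqNgt; apply/negP => lt_s.
have [m fm nIm] : exists2 m, m \in msupp f & ~ I 'X_[m].
  apply: contra_notP A1 => all_I; rewrite Ef /colon /= mul1r.
  apply: ideal_msupp => // m fm; apply: contra_notP all_I => nIm.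
  by exists m.
pose N := mdeg m; pose t := [seq x ^+ N.+1 | x <- s].
have [|g rel gA] := @algebraic_dependence A t; first by rewrite size_map.
have Ifg : I (f * g) by rewrite mulrC; move: gA; rewrite Ef.
have := lex_relation_regular hI (weakly_regular_expr N hI reg) rel Ifg.
pose U : set 'X_{1..n} := [set k | I 'X_[k] \/ (N < mdeg k)%N].
have gU : multigraded (monomial_span U).
  apply: monomial_span_multigraded => k k' [Ik|lt_k]; [left|right].
    by rewrite mpolyXD; apply: idealMl.
  by rewrite mdegD (leq_trans lt_k) ?leq_addl.
suff sub : ideal_add I t `<=` monomial_span U.
  by move=> /sub/(_ m fm)[//|]; rewrite ltnn.
apply: ideal_add_sub; first by case: gU.
  by move=> h Ih k /(grI _ _ Ih); left.
by move=> _ /mapP[x /sm xm ->] k /(maxideal_expr xm); right.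
Qed.

Lemma is_depth_sym_seq I A : multigraded I -> ass I (var_ideal A) ->
  weakly_regular I (sym_seq (n - #|A|)) -> is_depth maxideal I (n - #|A|)%N.
Proof.
move=> gI assA reg; have [hI _] := gI; split.
  exists (sym_seq (n - #|A|)); split; first exact: size_sym_seq.
    exact: sym_seq_maxideal.
  split; first exact/weakly_regularP.
  apply: maxideal_add_proper => //; last exact: sym_seq_maxideal.
  case: assA => -[[_ A1] _] [f Ef] I1; apply: A1.
  by rewrite Ef /colon /=; apply: idealMr.
move=> d [s [<- sm [/weakly_regularP-/(_ hI) reg_s _]]].
exact: regular_length_le reg_s.
Qed.

Lemma ass_var_ideal A : ass (var_ideal A) (var_ideal A).
Proof.
split; first exact: var_ideal_prime.
by exists 1; apply/seteqP; split=> f; rewrite /colon /= mulr1.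
Qed.

Lemma card_le_n A : (#|A| <= n)%N.
Proof. by rewrite -[X in (_ <= X)%N]card_ord max_card. Qed.

Lemma is_depth_var_ideal A : is_depth maxideal (var_ideal A) (n - #|A|)%N.
Proof.
apply: is_depth_sym_seq.
- exact: var_ideal_multigraded.
- exact: ass_var_ideal.
- by apply: weakly_regular_sym_seq; rewrite subnK ?card_le_n.
Qed.

(** For the upper bound, elements separating the primes of a chain below
    var_ideal A, followed by a regular sequence of length n - |A| modulo
    var_ideal A, cannot be more than n in number. *)
Lemma is_height_var_ideal A : is_height (var_ideal A) #|A|.
Proof.
split.
  pose B k : {set 'I_n} := [set i in take k (enum A)]%SET.
  exists (fun k => var_ideal (B k)); split=> [i _|k lt_k|].
  - exact: var_ideal_prime.
  - have [i0 _] : exists i, i \in A.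
      by apply/card_gt0P; apply: leq_ltn_trans lt_k.
    have lt_k' : (k < size (enum A))%N by rewrite -cardE.
    have E : take k.+1 (enum A) = rcons (take k (enum A)) (nth i0 (enum A) k).
      exact: take_nth.
    split=> [f fB m /fB/exists_inP[i]|/(_ 'X_(nth i0 (enum A) k))].
      rewrite inE => ik mi; apply/exists_inP; exists i => //.
      by rewrite inE E mem_rcons in_cons ik orbT.
    rewrite !var_idealX !meetsU !inE E mem_rcons mem_head => /(_ isT) /=.
    have := enum_uniq A; rewrite -{1}(cat_take_drop k.+1 (enum A)) E cat_uniq.
    by case/and3P; rewrite rcons_uniq => /andP[/negPf-> _].
  - by congr var_ideal; apply/setP => i; rewrite inE cardE take_size mem_enum.
move=> h [c [pc cc Ec]]; rewrite leqNgt; apply/negP => lt_h.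
have /choice[x xP] i : exists y, (i < h)%N -> c i.+1 y /\ ~ c i y.
  have [/cc[_ nsub]|_] := boolP (i < h)%N; last by exists 0.
  apply: contra_notP nsub => nex f cf; apply: contra_notP nex => ncf.
  by exists f => _.
pose t := mkseq x h ++ sym_seq (n - #|A|).
have [|g rel g0] := @algebraic_dependence finset.set0 t.
  rewrite size_cat size_mkseq size_sym_seq cards0.
  by have := card_le_n A; lia.
have [i lt_i|i lt_i||g' rel' cg'] :=
    lex_relation_chain (c := c) (h := h) _ _ rel.
- exact: pc.
- by have [sub _] := cc i lt_i; have [] := xP i lt_i.
- suff -> : g = 0 by apply: ideal0; apply/prime_is_ideal/pc.
  apply/mpolyP => m; rewrite mcoeff0; apply: (proj1 (var_idealP _ _) g0).
  by apply/exists_inP => -[i]; rewrite inE.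
have hA := var_ideal_is_ideal A.
have reg : weakly_regular (var_ideal A) (sym_seq (n - #|A|)).
  by apply: weakly_regular_sym_seq; rewrite subnK ?card_le_n.
have : ideal_add (var_ideal A) (sym_seq (n - #|A|)) 1.
  by apply: lex_relation_regular reg rel' _ => //; rewrite mul1r -Ec.
apply: maxideal_add_proper; first exact: var_ideal_multigraded.
  by case: (var_ideal_prime A) => -[].
exact: sym_seq_maxideal.
Qed.

(** * Ass-decomposable ideals *)

Lemma ass_decomposable_ass_nonempty I :
  ass_decomposable I -> exists A, ass I (var_ideal A).
Proof.
elim=> {I} [I /is_monomial_ideal_multigraded gI _ primI|
            I i k _ _ _ _ _ _ _ _ [A assA]].
  by have [A] := primary_var_ideal gI primI; exists A.
by exists A; apply: ass_colon assA.
Qed.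

(** Both parts of a splitting have their associated primes among those of I,
    so one sequence, regular modulo all the variable ideals that occur, serves
    for the whole recursion. *)
Lemma ass_decomposable_regular I s : ass_decomposable I ->
  (forall A, ass I (var_ideal A) -> weakly_regular (var_ideal A) s) ->
  weakly_regular I s.
Proof.
elim=> {I} [I /is_monomial_ideal_multigraded gI _ primI|
            I i k /is_monomial_ideal_multigraded gI _ _ _ ass_add
            _ IHadd _ IHcolon] reg.
  by have [A /reg regA] := primary_var_ideal gI primI; apply.
apply: (@weakly_regular_ext _ _ ('X_i ^+ k)); first by case: gI.
  by apply: IHcolon => A /ass_colon; apply: reg.
by apply: IHadd => A; rewrite ass_add => -[assA _]; apply: reg.
Qed.

End MonomialIdeals.

Theorem theorem3p6 (K : fieldType) (n : nat) (I : set {mpoly K[n]})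
    (hmon : is_monomial_ideal I) (hdec : ass_decomposable I) :
  exists d b : nat,
    [/\ is_depth (graded_max_ideal K n) I d,
        is_min_over (ass I) (is_depth (graded_max_ideal K n)) d,
        is_bigheight I b,
        (b <= n)%N
      & d = (n - b)%N].
Proof.
have gI := is_monomial_ideal_multigraded hmon.
have [A0 assA0] := ass_decomposable_ass_nonempty hdec.
pose P (A : {set 'I_n}) := `[< ass I (@var_ideal K n A) >].
have PA0 : P A0 by apply/asboolP.
have [A /asboolP assA max_A] := @arg_maxnP _ A0 P (fun A => #|A|) PA0.
have le_A B : ass I (@var_ideal K n B) -> (#|B| <= #|A|)%N.
  by move=> assB; apply: max_A; apply/asboolP.
exists (n - #|A|)%N, #|A|; split=> //.
- apply: is_depth_sym_seq => //.
  apply: ass_decomposable_regular => // B.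
  move=> /le_A le_B; apply: weakly_regular_sym_seq.
  by rewrite (leq_trans (leq_add (leqnn _) le_B)) // subnK // card_le_n.
- split; first by exists (var_ideal A); last exact: is_depth_var_ideal.
  move=> p assp; have [B Ep] := ass_multigraded gI assp; rewrite Ep in assp *.
  exists (n - #|B|)%N; first exact: is_depth_var_ideal.
  by rewrite leq_sub2l // le_A.
- split; first by exists (var_ideal A); last exact: is_height_var_ideal.
  move=> p assp; have [B Ep] := ass_multigraded gI assp; rewrite Ep in assp *.
  by exists #|B|; [exact: is_height_var_ideal|apply: le_A].
- exact: card_le_n.
Qed.
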